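(* Let $(X,* )$ be a unital shelf. Then the one-term homology of $X$ is trivial in all positive dimensions; that is, $\widetilde{H}_n^{( * )}(X)=0$ for all $n\ge 0$.
   Context: A shelf is a set $X$ with a binary operation $*$ satisfying $(a*b)*c=(a*c)*(b*c)$ for all $a,b,c\in X$. A unital shelf is a shelf with an element $1$ such that $x*1=x=1*x$ for all $x\in X$. One-term homology of a shelf $(X,* )$: for $n\ge0$ let $C_n=\mathbb{Z}X^{n+1}$ be the free abelian group on $(n+1)$-tuples $(x_0,\dots,x_n)$ of elements of $X$. For $n\ge1$ and $0\le i\le n$ let $d^{( * )}_{i,n}:C_n\to C_{n-1}$ be the linear map with $d^{( * )}_{i,n}(x_0,\dots,x_n)=(x_0*x_i,x_1*x_i,\dots,x_{i-1}*x_i,x_{i+1},\dots,x_n)$ (in particular $d^{( * )}_{0,n}(x_0,\dots,x_n)=(x_1,\dots,x_n)$ and $d^{( * )}_{n,n}(x_0,\dots,x_n)=(x_0*x_n,\dots,x_{n-1}*x_n)$). Put $\partial^{( * )}_n=\sum_{i=0}^n(-1)^i d^{( * )}_{i,n}$ for $n\ge 1$ and $\partial^{( * )}_0=0$. Then $H^{( * )}_n(X)=\ker(\partial^{( * )}_n)/\mathrm{im}(\partial^{( * )}_{n+1})$. The augmented (reduced) one-term homology $\widetilde{H}^{( * )}_n(X)$ is the homology of the complex obtained by putting $C_{-1}=\mathbb{Z}$ and replacing $\partial_0^{( * )}$ by the augmentation $C_0\to\mathbb{Z}$, $x_0\mapsto 1$; thus $H_0^{( * )}(X)=\mathbb{Z}\oplus\widetilde{H}_0^{(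 * )}(X)$ and $H_n^{( * )}(X)=\widetilde{H}_n^{( * )}(X)$ for $n\ge1$. *)

(* Defs.v *)
From HB Require Import structures.
From mathcomp Require Import all_boot all_algebra boolp.
From mathcomp Require Import freeg.

Set Implicit Arguments.
Unset Strict Implicit.
Unset Printing Implicit Defensive.

Import GRing.Theory.

Local Open Scope ring_scope.

Definition shelf (X : Type) (star : X -> X -> X) : Prop :=
  forall a b c, star (star a b) c = star (star a c) (star b c).

Definition unital_shelf (X : Type) (star : X -> X -> X) : Prop :=
  shelf star /\ exists e : X, forall x, star x e = x /\ star e x = x.

Section Homology.
Variables (A B C : zmodType) (f : {additive A -> B}) (g : {additive B -> C}).

Definition is_cycle : {pred B} := [pred b | g b == 0].

Fact is_cycle_zmod_closed : zmod_closed is_cycle.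
Proof.
split=> [|b c]; rewrite !inE ?raddf0 //.
by move=> /eqP gb0 /eqP gc0; rewrite raddfB gb0 gc0 subrr.
Qed.

HB.instance Definition _ := GRing.isZmodClosed.Build B is_cycle
  is_cycle_zmod_closed.

Definition cycles : Type := {b : B | b \in is_cycle}.

HB.instance Definition _ := SubChoice.on cycles.
HB.instance Definition _ := [SubChoice_isSubZmodule of cycles by <:].

(* Boundaries are cut out inside the cycles, so this is all of im f exactly
   when g \o f = 0. *)
Definition is_boundary : {pred cycles} :=
  [pred z : cycles | `[< exists a : A, f a = val z >]].

Fact is_boundary_zmod_closed : zmod_closed is_boundary.
Proof.
split=> [|z w]; rewrite !inE; first by apply/asboolP; exists 0; rewrite !raddf0.
move=> /asboolP[a fa] /asboolP[b fb].
by apply/asboolP; exists (a - b); rewrite !raddfB fa fb.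
Qed.

HB.instance Definition _ := GRing.isZmodClosed.Build cycles is_boundary
  is_boundary_zmod_closed.

Definition homology : zmodType := Quotient.quot is_boundary.

End Homology.

Definition trivial_group (G : zmodType) : Prop := forall x : G, x = 0.

Section OneTerm.
Variables (X : choiceType) (star : X -> X -> X).

(* (n+1)-tuples generate the chains of degree n. *)
Definition chain (n : nat) : lmodType int := {freeg (n.+1.-tuple X) / int}.

(* [fintype.lift i j] skips the index i: it is j if j < i, and j.+1 otherwise. *)
Definition face_tuple n (i : 'I_n.+2) (x : n.+2.-tuple X) : n.+1.-tuple X :=
  [tuple let y := tnth x (fintype.lift i j) in
         if (j < i)%N then star y (tnth x i) else y | j < n.+1].

Definition face n (i : 'I_n.+2) : chain n.+1 -> chain n :=
  fglift (fun x => (<< face_tuple i x >> : chain n)).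

Definition boundary n (c : chain n.+1) : chain n :=
  \sum_(i < n.+2) (-1) ^+ i *: face i c.

Fact boundary_is_zmod_morphism n : zmod_morphism (@boundary n).
Proof.
move=> c d; rewrite /boundary -sumrB; apply: eq_bigr => i _.
by rewrite -scalerBr /face lift_is_additive.
Qed.

HB.instance Definition _ n := GRing.isZmodMorphism.Build
  (chain n.+1) (chain n) (@boundary n) (@boundary_is_zmod_morphism n).

(* C_{n-1} with C_{-1} = 0; the truncation 0.-1 = 0 is harmless since the
   differential out of C_0 is zero. *)
Definition differential n : {additive chain n -> chain n.-1} :=
  match n with
  | 0 => \0
  | m.+1 => @boundary m
  end.

Definition one_term_homology (n : nat) : zmodType :=
  homology (@boundary n) (differential n).

(* C_{n-1} in the augmented complex, where C_{-1} is the group of integers. *)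
Definition aug_chain_pred (n : nat) : zmodType :=
  match n with
  | 0 => int
  | m.+1 => chain m
  end.

(* [deg] sums the coefficients: it is the augmentation sending each generator
   to 1. *)
Definition aug_differential n : {additive chain n -> aug_chain_pred n} :=
  match n with
  | 0 => @deg _
  | m.+1 => @boundary m
  end.

Definition reduced_one_term_homology (n : nat) : zmodType :=
  homology (@boundary n) (aug_differential n).

End OneTerm.

(* Main.v *)
Require Import Defs.
From mathcomp Require Import all_boot all_algebra.
From HB Require Import structures.
From mathcomp Require Import boolp freeg.

(** The reason is the right unit law [x * e = x] alone.  Appending [e] to a
    tuple, [(x_0, ..., x_n) |-> (x_0, ..., x_n, e)], gives, up to sign, a
    contracting homotopy [cone e] of the augmented complex.  The last face of
    the cone multiplies every [x_j] by [e] on the right and so returns the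
    original tuple ([face_max_cone]); every other face leaves the last entry
    alone, so for [n > 0] it commutes with [cone e] ([face_cone]).  For [n > 0]
    this gives [boundary (cone e c) = cone e (boundary c) + (-1)^(n+1) c]
    ([boundary_cone]).  For [n = 0] the first face of the cone of a vertex is
    the vertex [(e)], so that [boundary (cone e c) = deg c (e) - c]
    ([boundary_cone0]).  Hence every cycle of the augmented complex is, up to
    sign, the boundary of its cone. *)

Set Implicit Arguments.
Unset Strict Implicit.
Unset Printing Implicit Defensive.

Import GRing.Theory.

Local Open Scope ring_scope.

Lemma additive_scalez (U V : lmodType int) (f : {additive U -> V}) k u :
  f (k *: u) = k *: f u.
Proof. by rewrite -[k]intz !scaler_int raddfMz. Qed.

(** The generator of the chain group given by a tuple. *)
Definition simplex (X : choiceType) n (x : n.+1.-tuple X) : chain X n := << x >>.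

(** An additive map out of a chain group is determined by its values on
    simplices. *)
Lemma chain_additive_ext (X : choiceType) n (M : zmodType)
    (f g : {additive chain X n -> M}) :
  (forall x, f (simplex x) = g (simplex x)) -> f =1 g.
Proof.
move=> fg; elim/freeg_ind_dom0 => [|k x c _ _ IHc]; first by rewrite !raddf0.
have -> : << k *g x >> = simplex x *~ k by rewrite /simplex freegU_mulz intz.
by rewrite !raddfD IHc !raddfMz fg.
Qed.

(** Only the inclusion of [ker g] in [im f] is needed; the composite [g \o f]
    need not vanish, since boundaries are taken among the cycles. *)
Lemma homology_trivial (A B C : zmodType)
    (f : {additive A -> B}) (g : {additive B -> C}) :
  (forall b, g b = 0 -> exists a, f a = b) -> trivial_group (homology f g).
Proof.
move=> exact_fg; elim/quotW => z.
have /eqP -> : (z == 0 %[mod {ideal_quot @is_boundary A B C f g}])%qT.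
  rewrite -Quotient.idealrBE subr0.
  by apply/asboolP/exact_fg/eqP; exact: (valP z).
exact: (raddf0 (\pi_({ideal_quot @is_boundary A B C f g})%qT)).
Qed.

Section Cone.
Variables (X : choiceType) (star : X -> X -> X) (e : X).

(** The linear map sending the generator [(x_0, ..., x_n)] to
    [(x_0, ..., x_n, e)]. *)
Definition cone n : chain X n -> chain X n.+1 :=
  fglift (fun x : n.+1.-tuple X => simplex (rcons_tuple x e)).

HB.instance Definition _ n := GRing.isZmodMorphism.Build
  (chain X n) (chain X n.+1) (@cone n) (lift_is_additive _).

HB.instance Definition _ n (i : 'I_n.+2) := GRing.isZmodMorphism.Build
  (chain X n.+1) (chain X n) (face star i) (lift_is_additive _).

Lemma coneU n (x : n.+1.-tuple X) : cone (simplex x) = simplex (rcons_tuple x e).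
Proof. by rewrite /cone liftU scale1r. Qed.

Lemma faceU n (i : 'I_n.+2) (x : n.+2.-tuple X) :
  face star i (simplex x) = simplex (face_tuple star i x).
Proof. by rewrite /face liftU scale1r. Qed.

Lemma tnth_rcons_lt n (x : n.-tuple X) (j : 'I_n.+1) (k : 'I_n) :
  j = k :> nat -> tnth (rcons_tuple x e) j = tnth x k.
Proof.
by move=> jk; rewrite !(tnth_nth e) /= nth_rcons size_tuple jk ltn_ord.
Qed.

Lemma tnth_rcons_max n (x : n.-tuple X) (j : 'I_n.+1) :
  j = n :> nat -> tnth (rcons_tuple x e) j = e.
Proof.
by move=> jn; rewrite (tnth_nth e) /= nth_rcons size_tuple jn ltnn eqxx.
Qed.

Lemma face_tuple_rcons n (i : 'I_n.+2) (x : n.+2.-tuple X) :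
  face_tuple star (widen_ord (leqnSn _) i) (rcons_tuple x e)
  = rcons_tuple (face_tuple star i x) e.
Proof.
apply: eq_from_tnth => j; rewrite tnth_mktuple.
have -> : tnth (rcons_tuple x e) (widen_ord (leqnSn _) i) = tnth x i.
  exact: tnth_rcons_lt.
have [jn | nj] := ltnP j n.+1.
  pose k := Ordinal jn.
  rewrite (@tnth_rcons_lt _ _ j k) // tnth_mktuple.
  by rewrite (@tnth_rcons_lt _ x _ (fintype.lift i k)).
(* Otherwise j is the last index, where both tuples carry e. *)
have jE : j = n.+1 :> nat by apply/eqP; rewrite eqn_leq nj -ltnS ltn_ord.
have ij : (i <= j)%N by rewrite jE -ltnS.
rewrite (tnth_rcons_max _ jE) tnth_rcons_max /= ?ltnNge ?ij //.
by rewrite /bump ij jE.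
Qed.

(** In degree 0 the face that commuted with the cone in higher degrees yields
    the fixed vertex [(e)]: this is where the augmentation enters. *)
Lemma face_tuple_rcons0 (x : 1.-tuple X) :
  face_tuple star (ord0 : 'I_2) (rcons_tuple x e) = [tuple e].
Proof.
apply: eq_from_tnth => j; rewrite ord1 tnth_mktuple /=.
by rewrite tnth_rcons_max.
Qed.

Hypothesis star_e : forall x, star x e = x.

Lemma face_max_tuple_rcons n (x : n.+1.-tuple X) :
  face_tuple star ord_max (rcons_tuple x e) = x.
Proof.
apply: eq_from_tnth => j; rewrite tnth_mktuple /= ltn_ord.
rewrite (@tnth_rcons_lt _ x _ j) ?tnth_rcons_max //.
by rewrite /= /bump leqNgt ltn_ord.
Qed.

Lemma face_cone n (i : 'I_n.+2) (c : chain X n.+1) :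
  face star (widen_ord (leqnSn _) i) (cone c) = cone (face star i c).
Proof.
apply: (chain_additive_ext (f := face star (widen_ord (leqnSn _) i) \o @cone _)
         (g := @cone _ \o face star i)) => x /=.
by rewrite faceU !coneU faceU face_tuple_rcons.
Qed.

Lemma face_max_cone n (c : chain X n) : face star ord_max (cone c) = c.
Proof.
apply: (chain_additive_ext (f := face star ord_max \o @cone _) (g := idfun)).
by move=> x /=; rewrite coneU faceU face_max_tuple_rcons.
Qed.

Lemma boundary_cone n (c : chain X n.+1) :
  boundary star (cone c) = cone (boundary star c) + (-1) ^+ n.+2 *: c.
Proof.
rewrite /boundary big_ord_recr /= face_max_cone; congr (_ + _).
rewrite raddf_sum; apply: eq_bigr => i _.
by rewrite face_cone additive_scalez.
Qed.

Lemma boundary_cone0 (c : chain X 0) :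
  boundary star (cone c) = simplex [tuple e] *~ deg c - c.
Proof.
rewrite /boundary !big_ord_recr big_ord0 /= add0r face_max_cone.
rewrite expr0 expr1 scale1r scaleN1r; congr (_ - _).
apply: (chain_additive_ext (f := face star _ \o @cone 0)
  (g := intmul (simplex [tuple e]) \o @deg _)) => x /=.
rewrite coneU faceU degU mulr1z; congr simplex.
rewrite -(face_tuple_rcons0 x); congr face_tuple; exact: val_inj.
Qed.

End Cone.

Theorem theorem3p2 (X : choiceType) (star : X -> X -> X)
    (hX : unital_shelf star) :
  (forall n : nat, (0 < n)%N -> trivial_group (one_term_homology star n)) /\
  (forall n : nat, trivial_group (reduced_one_term_homology star n)).
Proof.
case: hX => _ [e /all_and2[star_e _]].
have fill n (c : chain X n.+1) :
    boundary star c = 0 -> exists a, boundary star a = c.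
  move=> c0; exists ((-1) ^+ n.+2 *: cone e c).
  rewrite additive_scalez /= boundary_cone // c0 raddf0 add0r.
  by rewrite scalerA -expr2 sqrr_sign scale1r.
split=> [[//|n] _|[|n]]; apply: homology_trivial => c c0; try exact: fill.
exists (- cone e c).
by rewrite raddfN /= boundary_cone0 // c0 mulr0z sub0r opprK.
Qed.
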